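(* Let $\mathcal{A}$, with order $\le$ on $\mathcal{A}_{\mathrm{H}}$, be a radical Archimedean ordered $^*$-algebra in which the square root $\sqrt{a}$ exists for all $a\in\mathcal{A}_{\mathrm{H}}^+$. If $\preccurlyeq$ is any order on $\mathcal{A}_{\mathrm{H}}$ such that the $^*$-algebra $\mathcal{A}$ with $\preccurlyeq$ is an ordered $^*$-algebra, then $\le$ and $\preccurlyeq$ coincide.
   Context: A $^*$-algebra is a unital associative complex algebra $\mathcal{A}$ (unit $\mathbb{1}$) with an antilinear involution $a\mapsto a^*$ satisfying $(ab)^*=b^*a^*$; $\mathcal{A}_{\mathrm{H}}=\{a\in\mathcal{A}: a=a^*\}$. An ordered $^*$-algebra is a $^*$-algebra $\mathcal{A}$ with a partial order $\le$ on $\mathcal{A}_{\mathrm{H}}$ such that $a+c\le b+c$, $d^*ad\le d^*bd$ and $0\le\mathbb{1}$ for all $a,b,c\in\mathcal{A}_{\mathrm{H}}$ with $a\le b$ and all $d\in\mathcal{A}$. Write $\mathcal{A}_{\mathrm{H}}^+=\{a\in\mathcal{A}_{\mathrm{H}}: a\ge 0\}$. It is Archimedean if, for $v,w\in\mathcal{A}_{\mathrm{H}}$, $v\le\epsilon w$ for all $\epsilon>0$ implies $v\le 0$. An element $a\in\mathcal{A}_{\mathrm{H}}$ is coercive if $a\ge\epsilon\mathbb{1}$ for some $\epsilon>0$. $\mathcal{A}$ is radical if, whenever $a,b\in\mathcal{A}_{\mathrm{H}}$ commute, $a$ is coercive and $ab\ge 0$, then $b\ge 0$. For $S\subseteq\mathcal{A}$,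 $S'$ is the commutant of $S$ in $\mathcal{A}$ and $S''=(S')'$. In a radical Archimedean ordered $^*$-algebra, the square root of $a\in\mathcal{A}_{\mathrm{H}}^+$ is (if it exists) the (necessarily unique) element $\sqrt{a}\in\{a\}''\cap\mathcal{A}_{\mathrm{H}}^+$ with $\sqrt{a}^{\,2}=a$. *)

(* Defs.v *)
From HB Require Import structures.
From mathcomp Require Import all_boot all_order all_algebra.
From mathcomp Require Import classical_sets reals complex.

Set Implicit Arguments.
Unset Strict Implicit.
Unset Printing Implicit Defensive.

Import GRing.Theory Num.Theory.
Local Open Scope ring_scope.
Local Open Scope complex_scope.
Local Open Scope classical_set_scope.

(* The library's algType is built on nzRingType and so excludes the zero      *)
(* algebra, while pzRingType allows 1 = 0. Hierarchy Builder admits no new    *)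
(* join of pzRingType and lmodType below lalgType; hence scalar               *)
(* multiplication is a field of the mixin, and the lmodType structure is      *)
(* recovered from it afterwards, so that k *: x is available.                 *)
HB.mixin Record PzRing_isStarAlgebra (R : realType) A of GRing.PzRing A := {
  cscale : R[i] -> A -> A;
  cscaleA : forall (k l : R[i]) (x : A),
    cscale k (cscale l x) = cscale (k * l) x;
  cscale1 : left_id 1 cscale;
  cscaleDr : right_distributive cscale +%R;
  cscaleDl : forall x : A, {morph cscale^~ x : k l / k + l};
  cscaleAl : forall (k : R[i]) (x y : A), cscale k (x * y) = cscale k x * y;
  cscaleAr : forall (k : R[i]) (x y : A), cscale k (x * y) = x * cscale k y;
  star : A -> A;
  starD : {morph star : x y / x + y};
  star_cscale : forall (k : R[i]) (x : A),
    star (cscale k x) = cscale (conjc k) (star x);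
  starM : forall x y : A, star (x * y) = star y * star x;
  starK : involutive star
}.

#[short(type="starAlgType")]
HB.structure Definition StarAlgebra (R : realType) :=
  {A of GRing.PzRing A & PzRing_isStarAlgebra R A}.

#[non_forgetful_inheritance]
HB.instance Definition _ (R : realType) (A : starAlgType R) :=
  GRing.Zmodule_isLmodule.Build R[i] (StarAlgebra.sort A)
    (@cscaleA R A) (@cscale1 R A) (@cscaleDr R A) (@cscaleDl R A).

Section OrderedStarAlgebra.
Context {R : realType} {A : starAlgType R}.

Definition hermitian_elt : set A := [set a | star a = a].

Definition commutant (S : set A) : set A :=
  [set b | forall a, S a -> GRing.comm a b].

(* An order on the Hermitian elements is encoded as a relation on the whole   *)
(* algebra of which only the restriction to Hermitian elements is ever used.  *)
Implicit Type le : A -> A -> Prop.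

Record ordered_star_algebra le : Prop := OrderedStarAlgebra {
  osa_refl : forall a, hermitian_elt a -> le a a;
  osa_antisym : forall a b, hermitian_elt a -> hermitian_elt b ->
    le a b -> le b a -> a = b;
  osa_trans : forall a b c, hermitian_elt a -> hermitian_elt b -> hermitian_elt c ->
    le a b -> le b c -> le a c;
  osa_add : forall a b c, hermitian_elt a -> hermitian_elt b -> hermitian_elt c ->
    le a b -> le (a + c) (b + c);
  osa_conj : forall a b d, hermitian_elt a -> hermitian_elt b ->
    le a b -> le (star d * a * d) (star d * b * d);
  osa_le01 : le 0 1
}.

Definition positive_elt le : set A := [set a | hermitian_elt a /\ le 0 a].

Definition archimedean le : Prop :=
  forall v w, hermitian_elt v -> hermitian_elt w ->
    (forall eps : R, 0 < eps -> le v (eps%:C *: w)) -> le v 0.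

Definition coercive le (a : A) : Prop :=
  hermitian_elt a /\ exists2 eps : R, 0 < eps & le (eps%:C *: (1 : A)) a.

Definition radical le : Prop :=
  forall a b, hermitian_elt a -> hermitian_elt b -> GRing.comm a b ->
    coercive le a -> le 0 (a * b) -> le 0 b.

Definition is_square_root le (a s : A) : Prop :=
  [/\ commutant (commutant [set a]) s, positive_elt le s & s ^+ 2 = a].

End OrderedStarAlgebra.

(* Main.v *)
Require Import Defs.
From mathcomp Require Import all_boot all_order all_algebra.
From mathcomp Require Import classical_sets reals complex.

(** Squares of Hermitian elements are positive for every order, so square
    roots make each [le]-positive element [le']-positive. Conversely let
    [0 <=' a], put [s := sqrt (a ^+ 2)] and [m := s - a]. Both [m * s * m] and
    [m * a * m] are [le']-positive, and their sum [m * (s + a) * m] vanishes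
    because [s] commutes with [a]. So both vanish, hence [m ^+ 3 = 0]. The
    Archimedean property of [le] rules out nonzero nilpotent Hermitian
    elements, so [a = s] is [le]-positive. *)

Set Implicit Arguments.
Unset Strict Implicit.
Unset Printing Implicit Defensive.

Import Order.TTheory GRing.Theory Num.Theory.
Local Open Scope ring_scope.
Local Open Scope complex_scope.

Section Star.
Context {R : realType} {A : starAlgType R}.
Implicit Types (a b x y : A) (r : R).

Lemma star0 : star (0 : A) = 0.
Proof. by apply: (addrI (star 0)); rewrite -starD !addr0. Qed.

Lemma starN x : star (- x) = - star x.
Proof. by apply: (addrI (star x)); rewrite -starD !subrr star0. Qed.

Lemma star1 : star (1 : A) = 1.
Proof. by rewrite -[LHS]mulr1 -{2}[1]starK -starM mulr1 starK. Qed.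

Lemma hermitian0 : hermitian_elt (0 : A).
Proof. exact: star0. Qed.

Lemma hermitian1 : hermitian_elt (1 : A).
Proof. exact: star1. Qed.

Lemma hermitianN x : hermitian_elt x -> hermitian_elt (- x).
Proof. by rewrite /hermitian_elt /= starN => ->. Qed.

Lemma hermitianD x y :
  hermitian_elt x -> hermitian_elt y -> hermitian_elt (x + y).
Proof. by rewrite /hermitian_elt /= starD => -> ->. Qed.

Lemma hermitianZ r x : hermitian_elt x -> hermitian_elt (r%:C *: x).
Proof.
by move=> hx; rewrite /hermitian_elt /= [LHS]star_cscale conjc_real hx.
Qed.

Lemma hermitianX x n : hermitian_elt x -> hermitian_elt (x ^+ n).
Proof.
move=> hx; elim: n => [|n IHn]; first exact: hermitian1.
by rewrite /hermitian_elt /= exprS starM IHn hx -exprSr exprS.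
Qed.

Lemma hermitian_conj x d :
  hermitian_elt x -> hermitian_elt (star d * x * d).
Proof. by move=> hx; rewrite /hermitian_elt /= !starM starK hx mulrA. Qed.

End Star.

Section Ordered.
Context {R : realType} {A : starAlgType R} (le : A -> A -> Prop).
Hypothesis le_ordered : ordered_star_algebra le.
Implicit Types (a b x y : A) (r : R).

(** Translation by [- x], and back by [x]. An order is thus determined by its positive elements, so
    comparing two orders amounts to comparing their cones. *)
Lemma le_subr_ge0 x y :
  hermitian_elt x -> hermitian_elt y -> le x y <-> le 0 (y - x).
Proof.
move=> hx hy; have hN := hermitianN hx; split=> h.
  by rewrite -(subrr x); exact: (osa_add le_ordered).
have := osa_add le_ordered hermitian0 (hermitianD hy hN) hx h.
by rewrite add0r subrK.
Qed.

Lemma conj_ge0 x d : hermitian_elt x -> le 0 x -> le 0 (star d * x * d).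
Proof.
move=> hx x0; have := osa_conj le_ordered d hermitian0 hx x0.
by rewrite mulr0 mul0r.
Qed.

(** Conjugate [0 <= 1] by [x], using [star x = x]. *)
Lemma sqr_ge0 x : hermitian_elt x -> le 0 (x ^+ 2).
Proof.
move=> hx; have := conj_ge0 x hermitian1 (osa_le01 le_ordered).
by rewrite hx mulr1 expr2.
Qed.

Lemma addr_eq0_ge0 x y : hermitian_elt x -> hermitian_elt y ->
  le 0 x -> le 0 y -> x + y = 0 -> x = 0.
Proof.
move=> hx hy x0 y0 /eqP; rewrite addr_eq0 => /eqP xE.
apply: (osa_antisym le_ordered) => //; first exact: hermitian0.
by apply/(le_subr_ge0 hx hermitian0); rewrite sub0r xE opprK.
Qed.

Hypothesis le_archimedean : archimedean le.

(* For [b ^+ 2 = 0], [eps + b] is the square of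
   [sqrt eps + b / (2 sqrt eps)]. *)
Lemma sqr_eq0_ge0 b : hermitian_elt b -> b ^+ 2 = 0 -> le 0 b.
Proof.
move=> hb b2; have hN := hermitianN hb.
suff: le (- b) 0 by move/(le_subr_ge0 hN hermitian0); rewrite sub0r opprK.
apply: (le_archimedean hN hermitian1) => eps eps0.
apply/(le_subr_ge0 hN (hermitianZ eps hermitian1)); rewrite opprK.
pose t : R := Num.sqrt eps; pose u : R := t^-1 / 2.
have t0 : t != 0 by rewrite sqrtr_eq0 -ltNge.
have -> : eps%:C *: (1 : A) + b = (t%:C *: (1 : A) + u%:C *: b) ^+ 2.
  have tuC : t%:C * u%:C = (2^-1)%:C :> R[i].
    by rewrite -rmorphM /= /u mulrA mulfV // mul1r.
  (* [*:] on [A] is [cscale] up to conversion, so the mixin laws apply. *)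
  have scAl k (x y : A) : k *: x * y = k *: (x * y) by rewrite [RHS]cscaleAl.
  have scAr k (x y : A) : x * (k *: y) = k *: (x * y) by rewrite [RHS]cscaleAr.
  (* Each of the two cross terms has coefficient [t * u = 1 / 2], so together they give [b]; the
     term in [b ^+ 2] vanishes. *)
  rewrite expr2 mulrDl !mulrDr !scAl !scAr !mul1r !mulr1 -expr2 b2 !scaler0.
  rewrite addr0 !scalerA [u%:C * _]mulrC tuC -rmorphM /= -expr2 sqr_sqrtr ?ltW//.
  rewrite -addrA -scalerDl -rmorphD /=.
  by rewrite -[2^-1]mul1r -splitr scale1r.
by apply: sqr_ge0; apply: hermitianD; apply: hermitianZ => //; exact: hermitian1.
Qed.

(** Both [b] and [- b] square to zero, so both are positive. *)
Lemma hermitian_sqr_eq0 b : hermitian_elt b -> b ^+ 2 = 0 -> b = 0.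
Proof.
move=> hb b2; have hN := hermitianN hb.
apply: (addr_eq0_ge0 hb hN); last exact: subrr.
- exact: sqr_eq0_ge0.
- by apply: sqr_eq0_ge0; rewrite ?sqrrN.
Qed.

(** As [b ^+ 4 = 0], the square-zero case applies to [b ^+ 2] and then to [b]. *)
Lemma hermitian_cube_eq0 b : hermitian_elt b -> b ^+ 3 = 0 -> b = 0.
Proof.
move=> hb b3; do 2?apply: hermitian_sqr_eq0 => //; first exact: hermitianX.
by rewrite -exprM exprS b3 mulr0.
Qed.

End Ordered.

Theorem proposition6p3 (R : realType) (A : starAlgType R)
    (le : A -> A -> Prop)
    (le_ordered : ordered_star_algebra le)
    (le_archimedean : archimedean le)
    (le_radical : radical le)
    (sqrt_exists : forall a : A, positive_elt le a ->
      exists s : A, is_square_root le a s)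
    (le' : A -> A -> Prop)
    (le'_ordered : ordered_star_algebra le') :
  forall a b : A, hermitian_elt a -> hermitian_elt b -> (le a b <-> le' a b).
Proof.
have le_sub (x : A) : hermitian_elt x -> le 0 x -> le' 0 x.
  move=> hx x0; have [s [_ [hs _] <-]] := sqrt_exists x (conj hx x0).
  exact: (sqr_ge0 le'_ordered hs).
suff le'_sub (x : A) : hermitian_elt x -> le' 0 x -> le 0 x.
  move=> a b ha hb; have hba := hermitianD hb (hermitianN ha).
  split.
    move=> /(le_subr_ge0 le_ordered ha hb)/(le_sub _ hba).
    by move=> /(le_subr_ge0 le'_ordered ha hb).
  move=> /(le_subr_ge0 le'_ordered ha hb)/(le'_sub _ hba).
  by move=> /(le_subr_ge0 le_ordered ha hb).
move=> hx x0.
have [s [scomm [hs s0] s2]] :=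
  sqrt_exists (x ^+ 2) (conj (hermitianX 2 hx) (sqr_ge0 le_ordered hx)).
have xs : x * s = s * x.
  (* [s] lies in the bicommutant of [x ^+ 2], and [x] commutes with [x ^+ 2]. *)
  by apply: scomm => _ ->; rewrite /GRing.comm -exprSr -exprS.
pose m := s - x.
have hm : hermitian_elt m := hermitianD hs (hermitianN hx).
have msx0 : m * s * m + m * x * m = 0.
  (* The factor [(s - x) * (s + x)] equals [s ^+ 2 - x ^+ 2 = 0]. *)
  rewrite -mulrDl -mulrDr /m mulrDr !mulrBl xs -!expr2 s2.
  by rewrite addrA subrK subrr mul0r.
have hc (y : A) : hermitian_elt y -> hermitian_elt (m * y * m).
  (* Since [m] is Hermitian, its left occurrence can be read as [star m]. *)
  by move=> hy; rewrite -{1}hm; exact: hermitian_conj.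
have pc (y : A) : hermitian_elt y -> le' 0 y -> le' 0 (m * y * m).
  by move=> hy y0; rewrite -{1}hm; exact: conj_ge0.
have ms0 : m * s * m = 0.
  exact: (addr_eq0_ge0 le'_ordered (hc _ hs) (hc _ hx)
            (pc _ hs (le_sub _ hs s0)) (pc _ hx x0) msx0).
have mx0 : m * x * m = 0 by move: msx0; rewrite ms0 add0r.
have m0 : m = 0.
  (* Here the argument returns to [le], the order assumed Archimedean. *)
  apply: (hermitian_cube_eq0 le_ordered le_archimedean hm).
  have -> : m ^+ 3 = m * (s - x) * m by rewrite exprSr expr2.
  by rewrite (mulrBr m) mulrBl ms0 mx0 subrr.
by move/eqP: m0; rewrite subr_eq0 => /eqP <-.
Qed.
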